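(* Let $\Omega$ be a bounded domain in $\mathbb{R}^2$ with Lipschitz boundary. For all $f\in\mathcal{H}^2=H^{1/2}(\partial\Omega)^2$, $$\mathcal{D}^{\mathrm{div}}[f](x)=\overline{\mathcal{C}[\overline f](x)},\quad x\in\mathbb{R}^2\setminus\partial\Omega,$$ and $$\mathcal{K}^{\mathrm{div}}[f]=\overline{\mathcal{C}_b[\overline f]}\quad\text{on }\partial\Omega.$$
   Context: Vectors $(v_1,v_2)\in\mathbb{R}^2$ are identified with $v_1+iv_2\in\mathbb{C}$ (both for points and for vector fields), and the bar is complex conjugation. The Cauchy integral is $\mathcal{C}[f](z)=\frac1{2\pi i}\int_{\partial\Omega}\frac{f(w)}{w-z}\,dw$ for $z\in\mathbb{C}\setminus\partial\Omega$, and the Cauchy transform is $\mathcal{C}_b[f](z)=\frac1{2\pi i}\,\mathrm{p.v.}\int_{\partial\Omega}\frac{f(w)}{w-z}\,dw$ for $z\in\partial\Omega$ (principal value), with $\partial\Omega$ positively oriented with respect to $\Omega$, i.e. $dw=i\,n_w\,d\sigma(w)$ with $n$ the outward unit normal. Fix Lamé constants $(\lambda,\mu)$ with $\mu>0$, $2\lambda+2\mu>0$; $k_0=\frac{\mu}{2(\lambda+2\mu)}$, $\alpha_1=\frac12\left(\frac1\mu+\frac1{\lambda+2\mu}\right)$, $\alpha_2=\frac12\left(\frac1\mu-\frac1{\lambda+2\mu}\right)$, $\Gamma_{ij}(x)=\frac{\alpha_1}{2\pi}\delta_{ij}\ln|x|-\frac{\alpha_2}{2\pi}\frac{x_ix_j}{|x|^2}$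 ($i,j=1,2$). Put $(x_1,x_2)^\perp=(-x_2,x_1)$ and $\mathrm{rot}\,u=-\frac{\partial u_1}{\partial x_2}+\frac{\partial u_2}{\partial x_1}$. The div-free conormal derivative is $\partial_\nu^{\mathrm{div}}u=\mu(\mathrm{rot}\,u)n^\perp+\frac{\mu}{2k_0}(\nabla\cdot u)n$, and $\partial^{\mathrm{div}}_{\nu_y}\Gamma(x-y)b=\partial^{\mathrm{div}}_{\nu_y}(\Gamma(x-y)b)$ for constant vectors $b$. The div-free double layer potential and div-free eNP operator are $\mathcal{D}^{\mathrm{div}}[f](x)=\int_{\partial\Omega}(\partial^{\mathrm{div}}_{\nu_y}\Gamma(x-y))^Tf(y)\,d\sigma(y)$ for $x\in\mathbb{R}^2\setminus\partial\Omega$, and $\mathcal{K}^{\mathrm{div}}[f](x)=\mathrm{p.v.}\int_{\partial\Omega}(\partial^{\mathrm{div}}_{\nu_y}\Gamma(x-y))^Tf(y)\,d\sigma(y)$ for $x\in\partial\Omega$. *)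

(* Defs.v *)
From HB Require Import structures.
From mathcomp Require Import all_boot all_order all_algebra.
From mathcomp Require Import all_classical all_reals all_analysis.
From mathcomp.real_closed Require Import complex.

Set Implicit Arguments.
Unset Strict Implicit.
Unset Printing Implicit Defensive.

Import Order.TTheory GRing.Theory Num.Theory.
Import numFieldNormedType.Exports.

Local Open Scope classical_set_scope.
Local Open Scope ring_scope.

Notation plane R := ('cV[R]_2).

Section plane.
Context {R : realType}.
Implicit Types v w : plane R.

Definition vec2 (a b : R) : plane R := \col_i (if i == 0 then a else b).

Definition toC v : R[i] := Complex (v 0 0) (v 1 0).

Definition perp v : plane R := vec2 (- v 1 0) (v 0 0).

Definition dot v w : R := \sum_i v i 0 * w i 0.

(* The norm provided by the library on column vectors is the sup norm. *)
Definition enorm v : R := Num.sqrt (dot v v).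

End plane.

Section hausdorff1.
Context {R : realType}.
Local Open Scope ereal_scope.
Implicit Types A : set (plane R).

(* The point 0 is added so that the empty set has diameter 0, not -oo. *)
Definition ediam A : \bar R :=
  ereal_sup (0 |` [set (enorm (x.1 - x.2))%:E | x in A `*` A]).

Definition hcover (delta : R) A : set ((set (plane R))^nat) :=
  [set F | A `<=` \bigcup_k F k /\ forall k, ediam (F k) <= delta%:E].

Definition hausdorff1_delta (delta : R) A : \bar R :=
  ereal_inf [set \sum_(k <oo) ediam (F k) | F in hcover delta A].

Definition hausdorff1 A : \bar R :=
  ereal_sup [set hausdorff1_delta delta A | delta in [set d | (0 < d)%R]].

Lemma ediam_ge0 A : 0 <= ediam A.
Proof. by apply: ereal_sup_ubound; left. Qed.

#[local] Hint Resolve ediam_ge0 : core.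

Lemma ediam0 : ediam set0 = 0.
Proof.
apply/eqP; rewrite eq_le ediam_ge0 andbT.
by apply: ge_ereal_sup => z [->|[x []]].
Qed.

Lemma hausdorff1_delta_ge0 d A : 0 <= hausdorff1_delta d A.
Proof.
apply: le_ereal_inf_tmp => _ [F _ <-].
by apply: nneseries_ge0 => n *; exact: ediam_ge0.
Qed.

Lemma hausdorff1_delta0 d : (0 < d)%R -> hausdorff1_delta d set0 = 0.
Proof.
move=> d0; apply/eqP; rewrite eq_le hausdorff1_delta_ge0 andbT.
apply: ereal_inf_lbound; exists (fun=> set0).
  by split => // k; rewrite ediam0 lee_fin ltW.
by rewrite eseries0// => i _ _; exact: ediam0.
Qed.

Lemma le_hausdorff1_delta d :
  {homo hausdorff1_delta d : A B / A `<=` B >-> A <= B}.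
Proof.
move=> A B AB; apply/ereal_inf_le_tmp => _ [F [BF Fd] <-].
by exists F => //; split => //; exact: subset_trans AB BF.
Qed.

Lemma hausdorff1_delta_sigma_subadditive d :
  sigma_subadditive (hausdorff1_delta d).
Proof.
move=> A; have [[i ioo]|] := pselect (exists i, hausdorff1_delta d (A i) = +oo).
  rewrite (eseries_pinfty _ _ ioo) ?leey// => n _.
  by rewrite -ltNye (lt_le_trans _ (hausdorff1_delta_ge0 _ _)).
rewrite -forallNE => Aoo.
apply/lee_addgt0Pr => _/posnumP[e].
rewrite (le_trans _ (epsilon_trick _ _ _))//; last first.
  by move=> n; exact: hausdorff1_delta_ge0.
pose P n (B : (set (plane R))^nat) := hcover d (A n) B /\
  \sum_(k <oo) ediam (B k) <=
    hausdorff1_delta d (A n) + (e%:num / (2 ^ n.+1)%:R)%:E.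
have [G PG] : {G : ((set (plane R))^nat)^nat & forall n, P n (G n)}.
  apply: (@choice _ _ P) => n; rewrite /P.
  have en1 : (0 < e%:num / (2 ^ n.+1)%:R)%R by [].
  have fn : hausdorff1_delta d (A n) \is a fin_num.
    by rewrite ge0_fin_numE ?hausdorff1_delta_ge0// ltey; apply/eqP.
  have [_ [B cB <-] xS] := lb_ereal_inf_adherent en1 fn.
  by exists B; split => //; exact/ltW.
have G_ge0 x : 0 <= (ediam \o uncurry G) x by exact: ediam_ge0.
apply: (@le_trans _ _ (\esum_(i in setT) (ediam \o uncurry G) i)).
  apply: ereal_inf_lbound => /=.
  have /card_esym/ppcard_eqP[f] := card_nat2.
  exists (uncurry G \o f).
    split => [t [i _ Ait]|k].
      have [j _ Gt] := (PG i).1.1 t Ait.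
      exists (f^-1%FUN (i, j)) => //=.
      by rewrite invK ?inE.
    by rewrite /= /uncurry; case: (f k) => i j; exact: (PG i).1.2.
  rewrite -(esum_pred_image (ediam \o uncurry G) _ xpredT) ?[fun=> _]set_true//.
  by rewrite image_eq.
rewrite (_ : esum _ _ = \sum_(i <oo) \sum_(j <oo ) ediam (G i j)); last first.
  pose J : nat -> set (nat * nat) := fun i => [set (i, j) | j in setT].
  rewrite (_ : setT = \bigcup_k J k); last first.
    by rewrite predeqE => -[a b]; split => // _; exists a => //; exists b.
  rewrite esum_bigcupT /=; last 2 first.
    - apply/trivIsetP => i j _ _ ij.
      rewrite predeqE => -[n m] /=; split => //= -[] [_] _ [<-{n} _].
      by move=> [m' _] [] /esym/eqP; rewrite (negbTE ij).
    - by move=> ?; exact: G_ge0.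
  rewrite -(image_id [set: nat]) -fun_true esum_pred_image//; last first.
    by move=> n _; exact: esum_ge0.
  apply: eq_eseriesr => /= j _.
  rewrite -(esum_pred_image (ediam \o uncurry G) (pair j) predT)//=; last first.
    by move=> ? ? _ _; exact: (@can_inj _ _ _ snd).
  by congr esum; rewrite predeqE => -[a b]; split; move=> [i _ <-]; exists i.
apply: lee_nneseries => [n _ _|n _]; last exact: (PG n).2.
by apply: nneseries_ge0 => m *; exact: ediam_ge0.
Qed.

Lemma le_hausdorff1_delta_sup d A : (0 < d)%R ->
  hausdorff1_delta d A <= hausdorff1 A.
Proof. by move=> d0; apply: ereal_sup_ubound; exists d. Qed.

Lemma hausdorff1_ge0 A : 0 <= hausdorff1 A.
Proof.
exact: le_trans (hausdorff1_delta_ge0 1 A) (le_hausdorff1_delta_sup _ ltr01).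
Qed.

Lemma hausdorff10 : hausdorff1 set0 = 0.
Proof.
apply/eqP; rewrite eq_le hausdorff1_ge0 andbT.
by apply: ge_ereal_sup => _ [d d0 <-]; rewrite hausdorff1_delta0.
Qed.

Lemma le_hausdorff1 : {homo hausdorff1 : A B / A `<=` B >-> A <= B}.
Proof.
move=> A B AB; apply: ge_ereal_sup => _ [d d0 <-].
exact: le_trans (le_hausdorff1_delta d AB) (le_hausdorff1_delta_sup _ d0).
Qed.

Lemma hausdorff1_sigma_subadditive : sigma_subadditive hausdorff1.
Proof.
move=> A; apply: ge_ereal_sup => _ [d d0 <-].
apply: le_trans (hausdorff1_delta_sigma_subadditive d A) _.
apply: lee_nneseries => [n _ _|n _]; first exact: hausdorff1_delta_ge0.
exact: le_hausdorff1_delta_sup.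
Qed.

HB.instance Definition _ := isOuterMeasure.Build R (plane R) hausdorff1
  hausdorff10 hausdorff1_ge0 le_hausdorff1 hausdorff1_sigma_subadditive.

End hausdorff1.

(* The plane with the sigma-algebra of Caratheodory measurable sets of the
   one-dimensional Hausdorff outer measure, and arc length on it. *)
Notation hplane R := (caratheodory_type (@hausdorff1 R)).

Section arclength.
Context {R : realType}.

Definition arclength : set (hplane R) -> \bar R := @hausdorff1 R.

HB.instance Definition _ := isMeasure.Build _ _ _ arclength
  (@caratheodory_measure0 _ _ (@hausdorff1 R))
  (@caratheodory_measure_ge0 _ _ (@hausdorff1 R))
  (@caratheodory_measure_sigma_additive _ _ (@hausdorff1 R)).

End arclength.

Section lipschitz_domain.
Context {R : realType}.
Implicit Types (Omega : set (plane R)) (p q n : plane R).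

Definition bdry Omega : set (plane R) := closure Omega `\` interior Omega.

(* In some orthonormal frame (e, perp e) centred at p, and in a rectangle
   around p, Omega is the region strictly above a Lipschitz graph. *)
Definition lipschitz_boundary_at Omega p : Prop :=
  exists (e : plane R) (r h L : R) (phi : R -> R),
    [/\ enorm e = 1, 0 < r, 0 < h,
        forall s t, `|phi s - phi t| <= L * `|s - t| &
        forall s t, `|s| < r -> `|t| < h ->
          (Omega (p + s *: e + t *: perp e) <-> phi s < t)].

Definition bounded_lipschitz_domain Omega : Prop :=
  [/\ open Omega, connected Omega, Omega !=set0, bounded_set Omega &
      forall p, bdry Omega p -> lipschitz_boundary_at Omega p].

(* The unit vector n is the outward normal at p when, near p, every cone about
   -n of aperture less than pi lies in Omega and every such cone about n lies
   outside the closure of Omega.  For a Lipschitz domain this holds exactly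
   where the local graph has a tangent, i.e. almost everywhere. *)
Definition is_outward_normal Omega p n : Prop :=
  enorm n = 1 /\
  forall eps : R, 0 < eps -> exists2 r : R, 0 < r &
    forall q, enorm (q - p) < r ->
      (dot (q - p) n < - (eps * enorm (q - p)) -> Omega q) /\
      (eps * enorm (q - p) < dot (q - p) n -> ~ closure Omega q).

Definition outward_normal Omega p : plane R :=
  xget 0 [set n | is_outward_normal Omega p n].

End lipschitz_domain.

Section boundary_integrals.
Context {R : realType}.
Implicit Types (D Omega : set (plane R)) (x : plane R).

Definition sint D (g : plane R -> R) : R := \int[arclength]_(y in D) g y.

Definition vint D (g : plane R -> plane R) : plane R :=
  \col_i sint D (fun y => g y i 0).

Definition cint D (g : plane R -> R[i]) : R[i] :=
  Complex (sint D (fun y => complex.Re (g y))) (sint D (fun y => complex.Im (g y))).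

Definition trunc D x (g : plane R -> R) (eps : R) : R :=
  sint (D `&` [set y | eps < enorm (y - x)]) g.

Definition pv_exists D x (g : plane R -> R) : Prop :=
  cvg (trunc D x g eps @[eps --> 0^'+]).

(* Equal to 0 when the limit does not exist. *)
Definition pv D x (g : plane R -> R) : R :=
  lim (trunc D x g eps @[eps --> 0^'+]).

Definition vpv_exists D x (g : plane R -> plane R) : Prop :=
  forall i, pv_exists D x (fun y => g y i 0).

Definition vpv D x (g : plane R -> plane R) : plane R :=
  \col_i pv D x (fun y => g y i 0).

Definition cpv_exists D x (g : plane R -> R[i]) : Prop :=
  pv_exists D x (fun y => complex.Re (g y)) /\
  pv_exists D x (fun y => complex.Im (g y)).

Definition cpv D x (g : plane R -> R[i]) : R[i] :=
  Complex (pv D x (fun y => complex.Re (g y)))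
          (pv D x (fun y => complex.Im (g y))).

(* H^(1/2) of the boundary, with the Sobolev-Slobodeckij seminorm. *)
Definition Hhalf Omega (g : plane R -> R) : Prop :=
  [/\ measurable_fun (bdry Omega : set (hplane R)) (g : hplane R -> R),
      (\int[arclength]_(y in bdry Omega) ((g y) ^+ 2)%:E < +oo)%E &
      (\int[arclength]_(x in bdry Omega) \int[arclength]_(y in bdry Omega)
         (((g x - g y) / enorm ((x : plane R) - y)) ^+ 2)%:E < +oo)%E].

Definition Hhalf2 Omega (f : plane R -> plane R) : Prop :=
  forall i, Hhalf Omega (fun y => f y i 0).

End boundary_integrals.

Section cauchy.
Context {R : realType}.
Implicit Types (Omega : set (plane R)) (h : plane R -> R[i]) (z : plane R).
Local Open Scope complex_scope.

(* The complex line element is dw = i n dsigma. *)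
Definition cauchy_integrand Omega h z (y : plane R) : R[i] :=
  h y / (toC y - toC z) * ('i * toC (outward_normal Omega y)).

Definition cauchy_integral Omega h z : R[i] :=
  (2 * pi%:C * 'i)^-1 * cint (bdry Omega) (cauchy_integrand Omega h z).

Definition cauchy_transform_exists Omega h z : Prop :=
  cpv_exists (bdry Omega) z (cauchy_integrand Omega h z).

Definition cauchy_transform Omega h z : R[i] :=
  (2 * pi%:C * 'i)^-1 * cpv (bdry Omega) z (cauchy_integrand Omega h z).

End cauchy.

Section lame.
Context {R : realType}.
Variables (lambda mu : R).
Implicit Types (u : plane R -> plane R) (x y n : plane R).

Definition k0 : R := mu / (2 * (lambda + 2 * mu)).
Definition alpha1 : R := 2^-1 * (mu^-1 + (lambda + 2 * mu)^-1).
Definition alpha2 : R := 2^-1 * (mu^-1 - (lambda + 2 * mu)^-1).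

Definition Gamma x : 'M[R]_2 := \matrix_(i, j)
  (alpha1 / (2 * pi) * (i == j)%:R * ln (enorm x)
   - alpha2 / (2 * pi) * (x i 0 * x j 0 / enorm x ^+ 2)).

Definition partial (i : 'I_2) (g : plane R -> R) y : R :=
  'D_(delta_mx i 0) g y.

Definition rot_field u y : R :=
  - partial 1 (fun z => u z 0 0) y + partial 0 (fun z => u z 1 0) y.

Definition divergence u y : R := \sum_i partial i (fun z => u z i 0) y.

Definition div_conormal n u y : plane R :=
  (mu * rot_field u y) *: perp n + (mu / (2 * k0) * divergence u y) *: n.

(* The matrix A such that A b is the div-free conormal derivative at y, with
   normal n, of z |-> Gamma (x - z) b. *)
Definition div_conormal_Gamma n x y : 'M[R]_2 := \matrix_(i, j)
  div_conormal n (fun z => Gamma (x - z) *m delta_mx j 0) y i 0.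

Variable Omega : set (plane R).
Implicit Type f : plane R -> plane R.

Definition Kdiv_integrand f x y : plane R :=
  (div_conormal_Gamma (outward_normal Omega y) x y)^T *m f y.

Definition Ddiv f x : plane R := vint (bdry Omega) (Kdiv_integrand f x).

Definition Kdiv_exists f x : Prop :=
  vpv_exists (bdry Omega) x (Kdiv_integrand f x).

Definition Kdiv f x : plane R := vpv (bdry Omega) x (Kdiv_integrand f x).

End lame.

(* Main.v *)
Require Import Defs.
From mathcomp Require Import all_boot all_order all_algebra.
From mathcomp Require Import all_classical all_reals all_analysis.
From mathcomp.real_closed Require Import complex.
From mathcomp Require Import ring lra.

Import Order.TTheory GRing.Theory Num.Theory.
Import numFieldNormedType.Exports.

Local Open Scope classical_set_scope.
Local Open Scope ring_scope.
Local Open Scope complex_scope.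

(** The two kernels agree pointwise. Write r = y - x, and let u be the field
    z |-> Gamma (x - z) b. Differentiating the Kelvin matrix at y gives
      div u = (alpha1 - alpha2) / (2 pi) * (r . b) / |r|^2,
      rot u = (alpha1 + alpha2) / (2 pi) * (r0 b1 - r1 b0) / |r|^2,
    and the Lame constants are such that
      mu (alpha1 + alpha2) = mu / (2 k0) * (alpha1 - alpha2) = 1.
    Hence both terms of the div-free conormal derivative carry the same factor,
    and since conj r * b = (r . b) + i (r0 b1 - r1 b0) and n^perp = i n, the
    conormal derivative is the complex number n b / (2 pi r): it is
    complex-linear in b ([div_conormal_GammaE]). The transpose of
    multiplication by a complex number is multiplication by its conjugate, so
    the double layer kernel applied to f is
      conj (n / r) f / (2 pi) = conj (n * conj f / r) / (2 pi),
    the conjugate of the Cauchy kernel applied to conj f, because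
    dw = i n dsigma cancels the i of 1 / (2 pi i) ([Kdiv_integrandE]).

    It remains to carry this identity, valid for y <> x, through the integrals.
    Off the boundary y <> x always holds. On it, the truncations defining the
    principal values remove y = x, and the limits exist simultaneously. The
    only operation on integrals is moving the factor 1 / (2 pi) in and out.
    The integrals are total functions, and the identity has to hold for their
    values whether or not the integrands, which involve the chosen outward
    normal, are measurable or integrable; positive homogeneity is therefore
    proved for arbitrary functions ([RintegralZl_pos]). *)

(** * Positive homogeneity of the integral for arbitrary functions *)

Section scaling.
Context d (T : measurableType d) (R : realType) (m : {measure set T -> \bar R}).
Local Open Scope ereal_scope.
Import HBNNSimple.

(** The integral of any function is the difference of the suprema below for its
    positive and negative parts, so identities between these suprema yield
    identities between integrals of functions of unknown measurability. *)
Definition lower_integral (g : T -> \bar R) : \bar R :=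
  ereal_sup [set sintegral m h |
    h in [set h : {nnsfun T >-> R} | forall x, (h x)%:E <= g x]].

Lemma lower_integral_ge0 (g : T -> \bar R) :
  (forall x, 0 <= g x) -> 0 <= lower_integral g.
Proof.
move=> g0; apply: ereal_sup_ubound; exists (@nnsfun0 _ T R) => //=.
exact: sintegral0.
Qed.

Lemma lower_integralZl_ge (c : R) (g : T -> \bar R) : (0 < c)%R ->
  c%:E * lower_integral g <= lower_integral (fun x => c%:E * g x).
Proof.
move=> c0; rewrite -lee_pdivlMl//; apply: ge_ereal_sup => _ [h /= hg <-].
rewrite lee_pdivlMl// -sintegralrM; apply: ereal_sup_ubound.
exists (scale_nnsfun h (ltW c0)) => //= x.
by rewrite EFinM lee_pmul2l// lte_fin.
Qed.

(** The reverse inequality is the previous one for the factor c^-1. *)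
Lemma lower_integralZl (c : R) (g : T -> \bar R) : (0 < c)%R ->
  lower_integral (fun x => c%:E * g x) = c%:E * lower_integral g.
Proof.
move=> c0; apply/eqP; rewrite eq_le lower_integralZl_ge// andbT.
rewrite -lee_pdivrMl//.
have ci0 : (0 < c^-1)%R by rewrite invr_gt0.
apply: (le_trans (lower_integralZl_ge _ _ ci0)).
rewrite [X in lower_integral X <= _](_ : _ = g)//.
by apply/funext => x; rewrite muleA -EFinM mulVf ?gt_eqF// mul1e.
Qed.

Lemma RintegralZl_pos (D : set T) (c : R) (g : T -> R) : (0 < c)%R ->
  (\int[m]_(x in D) (c * g x) = c * \int[m]_(x in D) g x)%R.
Proof.
move=> c0; rewrite /Rintegral.
have intE (h : T -> \bar R) : \int[m]_(x in D) h x =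
    lower_integral (h \_ D)^\+ - lower_integral (h \_ D)^\- by [].
under eq_integral do rewrite EFinM.
rewrite !intE erestrict_scale.
rewrite (ge0_funeposM _ (ltW c0)) (ge0_funenegM _ (ltW c0)) !lower_integralZl//.
have := @lower_integral_ge0 ((EFin \o g) \_ D)^\+ (fun=> funepos_ge0 _ _).
have := @lower_integral_ge0 ((EFin \o g) \_ D)^\- (fun=> funeneg_ge0 _ _).
(* When one of the two suprema is infinite, fine sends both sides to 0. *)
case: (lower_integral _) => [a| |]; case: (lower_integral _) => [b| |] //=;
  rewrite ?gt0_muley ?lte_fin ?mulr0//= => *.
by rewrite mulrBr.
Qed.

End scaling.

(** * Principal values of proportional integrands *)

Section principal_values.
Context {R : realType}.
Implicit Types (D : set (plane R)) (x : plane R) (g k : plane R -> R) (c : R).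

Lemma sintZl D g c : 0 < c -> sint D (fun y => c * g y) = c * sint D g.
Proof. exact: RintegralZl_pos. Qed.

Lemma eq_sint D g k : (forall y, D y -> g y = k y) -> sint D g = sint D k.
Proof. by move=> gk; apply: eq_Rintegral => y /set_mem/gk. Qed.

(** For eps > 0 the truncated domain omits x, so proportionality away from x is
    enough. *)
Lemma trunc_scaled D x g k c : 0 < c ->
  (forall y, D y -> y != x -> g y = c * k y) ->
  {near 0^'+, trunc D x g =1 (fun eps => c * trunc D x k eps)}.
Proof.
move=> c0 gk; near=> eps.
rewrite /trunc -sintZl//; apply: eq_sint => y [Dy /= xy]; apply: gk => //.
apply/eqP => yx; move: xy; apply/negP; rewrite -leNgt yx subrr.
have -> : enorm (0 : plane R) = 0.
  by rewrite /enorm /dot big1 ?sqrtr0// => i _; rewrite mxE mul0r.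
apply: ltW; near: eps; exact: nbhs_right_gt.
Unshelve. all: by end_near. Qed.

Lemma trunc_scaled_filter D x g k c : 0 < c ->
  (forall y, D y -> y != x -> g y = c * k y) ->
  trunc D x g eps @[eps --> 0^'+] = c * trunc D x k eps @[eps --> 0^'+].
Proof.
move=> c0 gk; have e := trunc_scaled _ _ _ _ _ c0 gk.
apply/seteqP; split; apply: near_eq_cvg => //.
by near do apply/esym.
Unshelve. all: by end_near. Qed.

Lemma pv_exists_scaled D x g k c : 0 < c ->
  (forall y, D y -> y != x -> g y = c * k y) ->
  pv_exists D x g <-> pv_exists D x k.
Proof.
move=> c0 gk; rewrite /pv_exists (trunc_scaled_filter _ _ _ _ _ c0 gk).
by rewrite is_cvgMlE_tmp ?gt_eqF.
Qed.

Lemma pv_scaled D x g k c : 0 < c ->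
  (forall y, D y -> y != x -> g y = c * k y) -> pv D x g = c * pv D x k.
Proof.
move=> c0 gk; have ex := pv_exists_scaled _ _ _ _ _ c0 gk.
have [kx|nkx] := pselect (pv_exists D x k); last first.
  (* A divergent limit has the default value 0, on both sides. *)
  have ngx : ~ pv_exists D x g by move/ex.
  by rewrite /pv (dvgP nkx) (dvgP ngx) mulr0.
rewrite /pv (trunc_scaled_filter _ _ _ _ _ c0 gk); apply/cvg_lim => //.
exact: cvgMl_tmp.
Qed.

End principal_values.

(** * Coordinates in the plane *)

Section coordinates.
Context {R : realType}.
Implicit Types (v w : plane R).

Lemma I2_cases (i : 'I_2) : i = 0 \/ i = 1.
Proof. by case: i => [[|[|//]]] ?; [left|right]; apply/val_inj. Qed.

Lemma sum_I2 (F : 'I_2 -> R) : \sum_i F i = F 0 + F 1.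
Proof.
by rewrite big_ord_recl big_ord1; congr (F _ + F _); apply/val_inj.
Qed.

Lemma dotE v w : dot v w = v 0 0 * w 0 0 + v 1 0 * w 1 0.
Proof. exact: sum_I2. Qed.

Lemma dotvv_ge0 v : 0 <= dot v v.
Proof. by rewrite dotE addr_ge0// -expr2 sqr_ge0. Qed.

Lemma dotvv_gt0 v : v != 0 -> 0 < dot v v.
Proof.
move=> v0; rewrite lt_neqAle dotvv_ge0 andbT eq_sym; apply: contra v0.
rewrite /dot psumr_eq0; last by move=> i _; rewrite -expr2 sqr_ge0.
move/allP => v0; apply/eqP/matrixP => i j; rewrite mxE (ord1 j).
by have /= := v0 i (mem_index_enum _); rewrite mulf_eq0 orbb => /eqP.
Qed.

Lemma sqr_enorm v : enorm v ^+ 2 = dot v v.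
Proof. by rewrite sqr_sqrtr ?dotvv_ge0. Qed.

(** At v = 0 both logarithms are ln 0 = 0, so the square root can be removed
    from the logarithmic potential everywhere. *)
Lemma ln_enorm v : ln (enorm v) = 2^-1 * ln (dot v v).
Proof.
have [->|v0] := eqVneq v 0.
  rewrite /enorm /dot big1 ?sqrtr0 ?ln0 ?mulr0// => i _.
  by rewrite mxE mul0r.
have n0 : 0 < enorm v by rewrite sqrtr_gt0 dotvv_gt0.
by rewrite -sqr_enorm lnXn// -[ln _ *+ 2]mulr_natl mulKf ?pnatr_eq0.
Qed.

Lemma dot_line v w (t : R) : dot (w - t *: v) (w - t *: v) =
  dot w w - 2 * t * dot w v + t ^+ 2 * dot v v.
Proof. rewrite !dotE !mxE; ring. Qed.

End coordinates.

(** * Derivatives of the Kelvin matrix *)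

Section kelvin_matrix.
Context {R : realType}.
Implicit Types (x y v : plane R).

(** Along a line, the chain and quotient rules of one-variable calculus apply to
    the logarithm and the inverse in the Kelvin matrix. *)
Lemma derive_line (g : plane R -> R) y v :
  'D_v g y = 'D_1 (fun t : R => g (t *: v + y)) 0.
Proof.
rewrite /derive; congr (lim (_ @ 0^')).
by apply/funext => h /=; rewrite addr0 scale0r add0r [h%:A]mulr1.
Qed.

Lemma Gamma_lineE lambda mu (i j : 'I_2) x y v (t : R) :
  Gamma lambda mu (x - (t *: v + y)) i j =
  let d := x - y in
  let N := dot d d - 2 * t * dot d v + t ^+ 2 * dot v v in
  alpha1 lambda mu / (2 * pi) * (i == j)%:R * (2^-1 * ln N)
   - alpha2 lambda mu / (2 * pi) *
     ((d i 0 - t * v i 0) * (d j 0 - t * v j 0) * N^-1).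
Proof.
have -> : x - (t *: v + y) = x - y - t *: v by rewrite opprD addrCA addrC.
by rewrite /= [LHS]mxE ln_enorm sqr_enorm dot_line !mxE.
Qed.

Lemma is_derive_affine (a b : R) :
  is_derive (0 : R) 1 (fun t : R => a - t * b) (- b).
Proof.
have H : is_derive (0 : R) 1 (fun t : R => a - b * t) (0 - b *: 1) :=
  is_deriveB (is_derive_cst a (0 : R) (1 : R)) (is_deriveZ b (is_derive_id _ _)).
under eq_fun do rewrite mulrC.
by apply: (is_derive_eq H); rewrite sub0r [_ *: _]mulr1.
Qed.

Lemma is_derive_quadratic (a b c : R) :
  is_derive (0 : R) 1 (fun t : R => a - 2 * t * b + t ^+ 2 * c) (- (2 * b)).
Proof.
have H : is_derive (0 : R) 1 (fun t : R => (a - t * (2 * b)) + c * (t * t))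
    (- (2 * b) + c *: (0 *: 1 + 0 *: 1)) :=
  is_deriveD (is_derive_affine a (2 * b))
    (is_deriveZ c (is_deriveM (is_derive_id (0 : R) (1 : R)) (is_derive_id _ _))).
have -> : (fun t : R => a - 2 * t * b + t ^+ 2 * c) =
    (fun t : R => (a - t * (2 * b)) + c * (t * t)) by apply/funext => t; ring.
by apply: (is_derive_eq H); rewrite !scale0r addr0 scaler0 addr0.
Qed.

Lemma derive_Gamma lambda mu (i j : 'I_2) x y v : y != x ->
  'D_v (fun z => Gamma lambda mu (x - z) i j) y =
  let d := x - y in
  - (alpha1 lambda mu / (2 * pi) * (i == j)%:R * (dot d v / dot d d)
     - alpha2 lambda mu / (2 * pi) *
       ((v i 0 * d j 0 + d i 0 * v j 0) / dot d d
         - 2 * d i 0 * d j 0 * dot d v / dot d d ^+ 2)).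
Proof.
move=> yx; rewrite derive_line; set d := x - y.
have d0 : 0 < dot d d by rewrite dotvv_gt0// subr_eq0 eq_sym.
under eq_fun do rewrite Gamma_lineE.
rewrite -/d /=.
set N := fun t : R => dot d d - 2 * t * dot d v + t ^+ 2 * dot v v.
have N0 : N 0 = dot d d by rewrite /N; ring.
have dN : is_derive (0 : R) 1 N (- (2 * dot d v)) by exact: is_derive_quadratic.
have dlnN : is_derive (0 : R) 1 (@ln R \o N) ((N 0)^-1 * (- (2 * dot d v))).
  by apply: is_derive1_comp; apply: is_derive1_ln; rewrite N0.
have dNV : is_derive (0 : R) 1 (fun t => (N t)^-1)
    (- N 0 ^- 2 *: (- (2 * dot d v))).
  by apply: is_deriveV => //; rewrite N0 gt_eqF.
have di := is_derive_affine (d i 0) (v i 0).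
have dj := is_derive_affine (d j 0) (v j 0).
set a := alpha1 _ _ / _ * _; set b := alpha2 _ _ / _.
have dF : is_derive (0 : R) 1 (fun t : R => a * 2^-1 * ln (N t) -
    b * ((d i 0 - t * v i 0) * (d j 0 - t * v j 0) * (N t)^-1)) _ :=
  is_deriveB (is_deriveZ (a * 2^-1) dlnN)
    (is_deriveZ b (is_deriveM (is_deriveM di dj) dNV)).
under [fun t : R => _]eq_fun do rewrite [a * (_ * _)]mulrA.
rewrite derive_val /GRing.scale/=.
rewrite -[(_ * _) 0]/((d i 0 - 0 * v i 0) * (d j 0 - 0 * v j 0)) N0.
have : dot d d != 0 by rewrite gt_eqF.
by move: (dot d d) => q q0; field.
Qed.

Lemma partial_GammaE lambda mu (i j k : 'I_2) x y : y != x ->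
  partial k (fun z => (Gamma lambda mu (x - z) *m delta_mx j 0 : plane R) i 0) y =
  let d := x - y in
  - (alpha1 lambda mu / (2 * pi) * (i == j)%:R * (d k 0 / dot d d)
     - alpha2 lambda mu / (2 * pi) *
       (((i == k)%:R * d j 0 + d i 0 * (j == k)%:R) / dot d d
         - 2 * d i 0 * d j 0 * d k 0 / dot d d ^+ 2)).
Proof.
move=> yx; rewrite /partial.
under [fun z => _]eq_fun do rewrite -colE mxE.
rewrite derive_Gamma//=.
have -> : dot (x - y) (delta_mx k 0) = (x - y) k 0.
  rewrite /dot (bigD1 k)//= big1 ?addr0 ?mxE ?eqxx ?mulr1// => l lk.
  by rewrite [delta_mx _ _ _ _]mxE (negbTE lk) mulr0.
by rewrite ![delta_mx _ _ _ _]mxE !andbT.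
Qed.

End kelvin_matrix.

(** * The double layer kernel is a conjugate Cauchy kernel *)

Section kernels.
Context {R : realType}.
Implicit Types (x y n : plane R).

(** The combinations alpha1 + alpha2 = 1 / mu of the rotation and
    alpha1 - alpha2 = 1 / (lambda + 2 mu) = 2 k0 / mu of the divergence cancel
    the coefficients of the conormal derivative. What remains is the matrix of
    b |-> n b / (2 pi r) in complex notation, r = y - x. *)
Lemma div_conormal_GammaE lambda mu n x y (i j : 'I_2) :
  0 < mu -> 0 < 2 * lambda + 2 * mu -> y != x ->
  div_conormal_Gamma lambda mu n x y i j =
  let r := y - x in
  (2 * pi)^-1 / dot r r *
    ((r 0 0 * (j == 1)%:R - r 1 0 * (j == 0)%:R) * perp n i 0 + r j 0 * n i 0).
Proof.
move=> mu0 ell yx.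
have pi0 : (pi : R) != 0 by rewrite gt_eqF ?pi_gt0.
have mun0 : mu != 0 by rewrite gt_eqF.
have lmu0 : lambda + 2 * mu != 0 by rewrite gt_eqF//; lra.
have : dot (x - y) (x - y) != 0 by rewrite gt_eqF ?dotvv_gt0// subr_eq0 eq_sym.
rewrite mxE /div_conormal /rot_field /divergence sum_I2 !partial_GammaE//=.
rewrite -[y - x]opprB; move: (pi : R) pi0 => p pi0.
have e01 : (0 == 1 :> 'I_2) = false by [].
have e10 : (1 == 0 :> 'I_2) = false by [].
move: (x - y) => d; rewrite !mxE !dotE !mxE /k0 /alpha1 /alpha2 => d0.
by have [->|->] := I2_cases j; rewrite ?eqxx ?e01 ?e10 /=; field;
  rewrite ?mulrNN ?d0 ?mun0 ?lmu0 ?pi0.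
Qed.

(** The Cauchy integrand Q contains the factor i of dw = i n dsigma, and the
    right-hand side is i * conj Q / (2 pi), that is conj (Q / (2 pi i)). *)
Lemma Kdiv_integrandE lambda mu (Omega : set (plane R)) f x y :
  0 < mu -> 0 < 2 * lambda + 2 * mu -> y != x ->
  let Q := cauchy_integrand Omega (fun z => (toC (f z))^*) x y in
  Kdiv_integrand lambda mu Omega f x y =
    (2 * pi)^-1 *: vec2 (complex.Im Q) (complex.Re Q).
Proof.
move=> mu0 ell yx; rewrite /cauchy_integrand /Kdiv_integrand.
set n := outward_normal _ _.
have r0 : dot (y - x) (y - x) != 0 by rewrite gt_eqF ?dotvv_gt0// subr_eq0.
have -> : toC y - toC x = toC (y - x) by rewrite /toC !mxE.
have pi0 : (pi : R) != 0 by rewrite gt_eqF ?pi_gt0.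
apply/matrixP => i j; rewrite (ord1 j) {j}.
rewrite mxE sum_I2 ![_^T _ _]mxE !div_conormal_GammaE//=.
move: (pi : R) pi0 => p pi0; move: (y - x) r0 => r; rewrite dotE !mxE => r0.
by have [->|->] := I2_cases i; rewrite /=; field; rewrite ?r0 ?pi0.
Qed.

Lemma conj_cauchy_normalization (a b : R) :
  ((2 * pi%:C * 'i)^-1 * Complex a b)^* =
  Complex ((2 * pi)^-1 * b) ((2 * pi)^-1 * a).
Proof.
have pi0 : (pi : R) != 0 by rewrite gt_eqF ?pi_gt0.
have -> : 2 * pi%:C * 'i = Complex 0 (2 * pi) :> R[i].
  rewrite -[2]/(2%:R : R[i]) -(rmorph_nat (real_complex R)).
  by apply/eqP; rewrite eq_complex /=; apply/andP; split; apply/eqP; ring.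
move: (pi : R) pi0 => p p0.
by apply/eqP; rewrite eq_complex /=; apply/andP; split; apply/eqP; field;
  rewrite ?p0.
Qed.

End kernels.

Theorem lemma9p1 (R : realType) (lambda mu : R)
  (mu_gt0 : 0 < mu) (elliptic : 0 < 2 * lambda + 2 * mu)
  (Omega : set (plane R)) (domOmega : bounded_lipschitz_domain Omega)
  (f : plane R -> plane R) (Hf : Hhalf2 Omega f) :
  (forall x : plane R, ~ bdry Omega x ->
     toC (Ddiv lambda mu Omega f x) =
       (cauchy_integral Omega (fun y => (toC (f y))^*) x)^*) /\
  (forall x : plane R, bdry Omega x ->
     (Kdiv_exists lambda mu Omega f x <->
        cauchy_transform_exists Omega (fun y => (toC (f y))^*) x) /\
     toC (Kdiv lambda mu Omega f x) =
       (cauchy_transform Omega (fun y => (toC (f y))^*) x)^*).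
Proof.
have c0 : 0 < (2 * pi)^-1 :> R by rewrite invr_gt0 mulr_gt0 ?pi_gt0.
have kernel0 x y : bdry Omega y -> y != x ->
    Kdiv_integrand lambda mu Omega f x y 0 0 = (2 * pi)^-1 *
      complex.Im (cauchy_integrand Omega (fun z => (toC (f z))^*) x y).
  by move=> _ yx; rewrite Kdiv_integrandE// !mxE.
have kernel1 x y : bdry Omega y -> y != x ->
    Kdiv_integrand lambda mu Omega f x y 1 0 = (2 * pi)^-1 *
      complex.Re (cauchy_integrand Omega (fun z => (toC (f z))^*) x y).
  by move=> _ yx; rewrite Kdiv_integrandE// !mxE.
split=> x xO.
- have offx y : bdry Omega y -> y != x.
    by move=> yO; apply: contra_notN xO => /eqP <-.
  rewrite conj_cauchy_normalization -!sintZl// /toC !mxE.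
  by congr Complex; apply: eq_sint => y yO; [apply: kernel0|apply: kernel1] => //;
    exact: offx.
- split.
    have ex0 := pv_exists_scaled _ _ _ _ _ c0 (kernel0 x).
    have ex1 := pv_exists_scaled _ _ _ _ _ c0 (kernel1 x).
    split=> [K|[K1 K0] i].
      by split; [exact: (proj1 ex1 (K 1))|exact: (proj1 ex0 (K 0))].
    have [->|->] := I2_cases i.
    - exact: (proj2 ex0 K0).
    - exact: (proj2 ex1 K1).
  rewrite conj_cauchy_normalization /toC !mxE.
  by rewrite (pv_scaled _ _ _ _ _ c0 (kernel0 x))
    (pv_scaled _ _ _ _ _ c0 (kernel1 x)).
Qed.
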